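(* Let $p$ be a prime and $n$ a positive integer. Let $P$ be the group of all $3 \times 3$ lower triangular matrices over the finite field $\mathbf{GF}(p^n)$ with $1$s along the diagonal. Then $\mathcal{CD}(P)$ is a quasi-antichain of width $p^n + 1$ and all atoms of $\mathcal{CD}(P)$ (the subgroups in the middle antichain) are abelian.
   Context: For a finite group $G$ and a subgroup $U \leq G$, the Chermak-Delgado measure of $U$ in $G$ is $m_G(U) = |U|\,|C_G(U)|$. Let $m^*(G)$ be the maximum of $m_G(U)$ over all subgroups $U \leq G$. The Chermak-Delgado lattice of $G$ is $\mathcal{CD}(G) = \{U \leq G : m_G(U) = m^*(G)\}$, ordered by inclusion (it is a sublattice of the subgroup lattice of $G$). A lattice is a quasi-antichain if it consists of a maximum, a minimum, and the atoms of the lattice (the atoms being distinct from the maximum and minimum, and pairwise incomparable); its width is the number of atoms. *)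

(* Defs.v *)
From HB Require Import structures.
From mathcomp Require Import all_boot all_order all_algebra all_fingroup.

Set Implicit Arguments.
Unset Strict Implicit.
Unset Printing Implicit Defensive.

Import GroupScope GRing.Theory.

Section ChermakDelgado.

Variables (gT : finGroupType) (G : {group gT}).

Definition cd_measure (U : {group gT}) : nat := (#|U| * #|'C_G(U)|)%N.

Definition cd_max : nat :=
  \max_(U : {group gT} | U \subset G) cd_measure U.

Definition cd_lattice : {set {group gT}} :=
  [set U : {group gT} | (U \subset G) && (cd_measure U == cd_max)].

End ChermakDelgado.

(* A set L of subgroups is regarded as a poset under inclusion.  In the       *)
(* following, minimum, maximum and atom are relative to L: the minimum of L   *)
(* need not be the trivial group.                                             *)
Section QuasiAntichain.

Variables (gT : finGroupType) (L : {set {group gT}}).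

Definition is_minimum (M : {group gT}) : bool :=
  (M \in L) && [forall B in L, M \subset B].

Definition is_maximum (M : {group gT}) : bool :=
  (M \in L) && [forall B in L, B \subset M].

Definition is_atom (A : {group gT}) : bool :=
  (A \in L) &&
  [exists M : {group gT}, [&& is_minimum M, M \proper A &
     ~~ [exists B in L, (M \proper B) && (B \proper A)]]].

Definition atoms : {set {group gT}} := [set A | is_atom A].

(* The condition top \notin atoms excludes chains of two elements; in         *)
(* chains of one element (bot = top) it holds and there are no atoms.  The    *)
(* incomparability clause is implied by the definition of atoms.              *)
Definition quasi_antichain (w : nat) : Prop :=
  exists bot top : {group gT},
    [/\ is_minimum bot, is_maximum top,
        L = [set bot; top] :|: atoms,
        (bot \notin atoms) && (top \notin atoms)
      & {in atoms &, forall A B : {group gT}, A \subset B -> A = B}]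
    /\ #|atoms| = w.

End QuasiAntichain.

Section LowerUnitriangular.

Local Open Scope ring_scope.

Variable F : finFieldType.

(* is_trig_mx A states that A i j = 0 for i < j, i.e., that A is lower        *)
(* triangular.                                                                *)
Definition lower_unitriangular_set : {set {'GL_3[F]}} :=
  [set g : {'GL_3[F]} |
    is_trig_mx (GLval g) && [forall i, GLval g i i == 1]].

Lemma lower_unitriangular_group_set : group_set lower_unitriangular_set.
Proof.
apply/group_setP; split.
  rewrite inE GL_1E /=; apply/andP; split; first exact: scalar_mx_is_trig.
  by apply/forallP => i; rewrite mxE eqxx.
move=> g h; rewrite !inE GL_ME => /andP[gT /forallP g1] /andP[hT /forallP h1].
move/is_trig_mxP: gT => gT; move/is_trig_mxP: hT => hT.
apply/andP; split.
  apply/is_trig_mxP => i j ltij; rewrite mxE big1 // => k _.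
  have [ltik|leki] := ltnP i k; first by rewrite gT // mul0r.
  by rewrite hT ?mulr0 // (leq_ltn_trans leki).
apply/forallP => i; rewrite mxE (bigD1 i) //= (eqP (g1 i)) (eqP (h1 i)) mul1r.
rewrite big1 ?addr0 // => k; rewrite neq_ltn => /orP[ltki|ltik].
  by rewrite hT ?mulr0.
by rewrite gT ?mul0r.
Qed.

Canonical lower_unitriangular : {group {'GL_3[F]}} :=
  Group lower_unitriangular_group_set.

End LowerUnitriangular.

(* Main.v *)
Require Import Defs.
From HB Require Import structures.
From mathcomp Require Import all_boot all_order all_algebra all_fingroup.
From mathcomp Require Import center.

(** The idea is that the centralisers of the noncentral elements of P are
    abelian.  The matrices with subdiagonal entries (a, b) and (a', b')
    commute exactly when b a' = b' a, that is, when the two vectors are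
    linearly dependent.  With q the order of the field, P has order q ^ 3,
    its centre is given by a = b = 0 and has order q, and the centraliser of a
    noncentral element consists of the matrices whose vector lies on a fixed
    line: it is abelian, of order q ^ 2 ([center_lut], [card_centraliser_lut],
    [abelian_centraliser_lut]).

    The rest holds in any group G with these properties.  Let x be a noncentral
    element.  As 'C_G[x] is abelian, every noncentral y in it satisfies
    'C_G[y] = 'C_G[x]; hence two noncentral elements which do not commute have
    no noncentral element in the intersection of their centralisers.  So a
    subgroup U of G has centraliser G, 'C_G[x] or 'Z(G), according to whether U
    is central, noncentral but inside some 'C_G[x], or neither
    ([cd_envelope]).  In each case U lies in a subgroup T, equal to 'Z(G),
    'C_G[x] or G respectively, with #|T| * #|'C_G(U)| = q ^ 4.  Hence the
    measure of U is at most q ^ 4, with equality exactly when U = T, and the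
    Chermak-Delgado lattice consists of 'Z(G), G and the subgroups 'C_G[x]
    ([cd_lattice_abelian_centralisers]).  These last are the atoms, and the
    sets 'C_G[x] :\: 'Z(G), of size q ^ 2 - q, partition G :\: 'Z(G), so that
    there are (q ^ 3 - q) / (q ^ 2 - q) = q + 1 of them. *)

Set Implicit Arguments.
Unset Strict Implicit.
Unset Printing Implicit Defensive.

Import GRing.Theory.

(** * Groups whose noncentral elements have abelian centralisers *)

Section AbelianCentralisers.

Local Open Scope group_scope.
Local Open Scope nat_scope.

Variables (gT : finGroupType) (G : {group gT}).

Definition noncentral_centralisers : {set {group gT}} :=
  [set 'C_G[x]%G | x in G :\: 'Z(G)].

Hypothesis abelC : {in G :\: 'Z(G), forall x, abelian 'C_G[x]}.

Lemma centraliser_in (x : gT) :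
  x \in G :\: 'Z(G) -> 'C_G[x]%G \in noncentral_centralisers.
Proof. exact: imset_f. Qed.

Lemma center_sub_cent1 (x : gT) : x \in G -> 'Z(G) \subset 'C_G[x].
Proof. by move=> Gx; rewrite setIS // -cent_set1 centS // sub1set. Qed.

(** Both centralisers are abelian and contain x and y, so each centralises the
    element that defines the other. *)
Lemma eq_centraliser (x y : gT) :
    x \in G :\: 'Z(G) -> y \in 'C_G[x] :\: 'Z(G) -> 'C_G[y] = 'C_G[x].
Proof.
have sub (u v : gT) : u \in G :\: 'Z(G) -> v \in 'C_G[u] ->
    'C_G[u] \subset 'C_G[v].
  move=> Du Cv; rewrite subsetI subsetIl sub_cent1.
  by apply: (subsetP (abelC Du)).
move=> Dx /setDP[Cy nZy]; have /setIP[Gy cxy] := Cy.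
have Dy : y \in G :\: 'Z(G) by rewrite inE nZy.
have [Gx _] := setDP Dx.
apply/eqP; rewrite eqEsubset; apply/andP; split; last exact: sub.
by apply: sub; rewrite // inE Gx cent1C.
Qed.

Lemma cent_noncentral_centraliser (x : gT) (U : {group gT}) :
    x \in G :\: 'Z(G) -> x \in U -> U \subset 'C_G[x] ->
  'C_G(U) = 'C_G[x].
Proof.
move=> Dx Ux sUC; apply/eqP; rewrite eqEsubset; apply/andP; split.
  by rewrite setIS // -cent_set1 centS // sub1set.
rewrite subsetI subsetIl; exact: subset_trans (abelC Dx) (centS sUC).
Qed.

Lemma cent_nonabelian (x : gT) (U : {group gT}) :
    x \in G :\: 'Z(G) -> U \subset G -> x \in U -> ~~ (U \subset 'C_G[x]) ->
  'C_G(U) = 'Z(G).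
Proof.
move=> Dx sUG Ux /subsetPn[y Uy nCy]; have Gy := subsetP sUG y Uy.
apply/eqP; rewrite eqEsubset; apply/andP; split; last by rewrite setIS ?centS.
apply/subsetP=> z /setIP[Gz cUz]; apply: contraR nCy => nZz.
have Cz u : u \in U -> z \in 'C_G[u].
  by move=> Uu; rewrite inE Gz; apply/cent1P; apply: (centP cUz).
have <- : 'C_G[z] = 'C_G[x] by apply: eq_centraliser; rewrite // inE nZz Cz.
by rewrite inE Gy cent1C; have /setIP[] := Cz y Uy.
Qed.

Variable q : nat.
Hypotheses (q_gt1 : 1 < q) (oG : #|G| = q ^ 3) (oZ : #|'Z(G)| = q).
Hypothesis oC : {in G :\: 'Z(G), forall x, #|'C_G[x]| = q ^ 2}.

Lemma cd_envelope (U : {group gT}) : U \subset G ->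
  exists2 T : {group gT},
    T \in [set 'Z(G)%G; G] :|: noncentral_centralisers &
    U \subset T /\ #|T| * #|'C_G(U)| = q ^ 4.
Proof.
move=> sUG; have [sUZ|/subsetPn[x Ux nZx]] := boolP (U \subset 'Z(G)).
  exists 'Z(G)%G; first by rewrite !inE eqxx.
  have -> : 'C_G(U) = G.
    apply/setIidPl; rewrite centsC; exact: subset_trans sUZ (subsetIr _ _).
  by rewrite sUZ oZ oG -expnS.
have Dx : x \in G :\: 'Z(G) by rewrite inE nZx (subsetP sUG).
have [sUC|nUC] := boolP (U \subset 'C_G[x]).
  exists 'C_G[x]%G; first by rewrite inE centraliser_in ?orbT.
  by rewrite (cent_noncentral_centraliser Dx) // oC // -expnD.
exists G; first by rewrite !inE eqxx orbT.
by rewrite (cent_nonabelian Dx) // oG oZ -expnSr.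
Qed.

Lemma cd_measure_envelope (T : {group gT}) :
  T \in [set 'Z(G)%G; G] :|: noncentral_centralisers ->
  T \subset G /\ cd_measure G T = q ^ 4.
Proof.
rewrite /cd_measure; case/setUP => [/set2P[]->|/imsetP[x Dx ->]].
- rewrite center_sub oZ (setIidPl _) ?oG -?expnS //.
  by rewrite centsC subsetIr.
- by rewrite subxx oG oZ -expnSr.
have [Gx _] := setDP Dx; rewrite subsetIl /=.
rewrite (@cent_noncentral_centraliser x) ?oC -?expnD //=.
by rewrite inE Gx cent1id.
Qed.

Lemma cd_measure_le (U : {group gT}) : U \subset G -> cd_measure G U <= q ^ 4.
Proof.
by case/cd_envelope=> T _ [sUT <-]; rewrite leq_mul2r subset_leq_card ?orbT.
Qed.

Lemma cd_max_abelian_centralisers : cd_max G = q ^ 4.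
Proof.
apply/eqP; rewrite eqn_leq; apply/andP; split.
  by apply/bigmax_leqP => U; apply: cd_measure_le.
have [|_ <-] := @cd_measure_envelope G; first by rewrite !inE eqxx orbT.
exact: (leq_bigmax_cond (F := cd_measure G)).
Qed.

Lemma cd_lattice_abelian_centralisers :
  cd_lattice G = [set 'Z(G)%G; G] :|: noncentral_centralisers.
Proof.
apply/setP=> U; rewrite inE cd_max_abelian_centralisers.
apply/andP/idP => [[sUG /eqP mU]|/cd_measure_envelope[-> ->] //].
have [T LT [sUT mT]] := cd_envelope sUG.
suffices -> : U = T by [].
apply/val_inj/eqP; rewrite eqEcard sUT /=.
by rewrite -(leq_pmul2r (cardG_gt0 'C_G(U))) mT -mU.
Qed.

Lemma noncentral_centraliserP (A : {group gT}) :
  A \in noncentral_centralisers ->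
  [/\ 'Z(G) \proper A, A \proper G, #|A| = q ^ 2 & abelian A].
Proof.
case/imsetP=> x Dx ->; have [Gx _] := setDP Dx.
rewrite !properEcard center_sub_cent1 // subsetIl oZ oG oC // abelC //.
by rewrite !ltn_exp2l // -{1}(expn1 q) ltn_exp2l.
Qed.

Lemma noncentral_neq0 : exists x, x \in G :\: 'Z(G).
Proof.
have /properP[_ [x Gx nZx]] : 'Z(G) \proper G.
  by rewrite properEcard center_sub oZ oG -{1}(expn1 q) ltn_exp2l.
by exists x; rewrite inE nZx.
Qed.

Lemma is_minimum_cd_lattice (M : {group gT}) :
  is_minimum (cd_lattice G) M = (M == 'Z(G)%G).
Proof.
rewrite /is_minimum cd_lattice_abelian_centralisers.
have LZ : 'Z(G)%G \in [set 'Z(G)%G; G] :|: noncentral_centralisers.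
  by rewrite !inE eqxx.
have minZ B : B \in [set 'Z(G)%G; G] :|: noncentral_centralisers ->
    'Z(G) \subset B.
  case/setUP=> [/set2P[]->|/noncentral_centraliserP[/proper_sub //]].
    exact: subxx.
  exact: center_sub.
apply/andP/eqP => [[LM /forall_inP minM]|->]; last first.
  by split=> //; apply/forall_inP.
by apply/val_inj/eqP; rewrite eqEsubset minM // minZ.
Qed.

Lemma is_maximum_cd_lattice : is_maximum (cd_lattice G) G.
Proof.
rewrite /is_maximum cd_lattice_abelian_centralisers !inE eqxx orbT /=.
by apply/forall_inP => B /cd_measure_envelope[].
Qed.

Lemma atoms_cd_lattice : atoms (cd_lattice G) = noncentral_centralisers.
Proof.
apply/setP=> A; rewrite inE /is_atom; apply/andP/idP.
  rewrite {1}cd_lattice_abelian_centralisers.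
  case=> LA /existsP[M]; rewrite is_minimum_cd_lattice.
  case/and3P=> /eqP-> ltZA /exists_inP noB.
  case/setUP: LA => [/set2P[]eA|//].
    by rewrite eA properxx in ltZA.
  (* A noncentral element of G yields a centraliser strictly between the
     centre and G, so G is not an atom. *)
  have [x Dx] := noncentral_neq0; case: noB; exists 'C_G[x]%G.
    by rewrite cd_lattice_abelian_centralisers inE centraliser_in ?orbT.
  rewrite eA.
  by have [-> -> _ _] := noncentral_centraliserP (centraliser_in Dx).
move=> CA; have [ltZA _ oA _] := noncentral_centraliserP CA.
split; first by rewrite cd_lattice_abelian_centralisers inE CA orbT.
apply/existsP; exists 'Z(G)%G; rewrite is_minimum_cd_lattice eqxx ltZA /=.
apply/exists_inP=> -[B]; rewrite cd_lattice_abelian_centralisers.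
case/setUP=> [/set2P[]->|CB] /andP[ltZB ltBA].
- by rewrite properxx in ltZB.
- have [_ ltAG _ _] := noncentral_centraliserP CA.
  by have := proper_trans ltBA ltAG; rewrite properxx.
have [_ _ oB _] := noncentral_centraliserP CB.
by have := proper_card ltBA; rewrite oA oB ltnn.
Qed.

Lemma card_noncentral_centralisers : #|noncentral_centralisers| = q + 1.
Proof.
have q2q : 0 < q ^ 2 - q by rewrite subn_gt0 -{1}(expn1 q) ltn_exp2l.
apply/eqP; rewrite -(eqn_pmul2r q2q); apply/eqP.
transitivity #|G :\: 'Z(G)|; last first.
  rewrite cardsD (setIidPr (center_sub G)) oG oZ.
  by rewrite mulnBr !mulnDl !mul1n -expnS -mulnn subnDA addnK.
symmetry; rewrite -sum1_card.
rewrite (partition_big_imset (fun x => 'C_G[x]%G)) -sum_nat_const.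
apply: eq_bigr => _ /imsetP[x Dx ->]; have [Gx _] := setDP Dx.
transitivity #|'C_G[x] :\: 'Z(G)|; last first.
  by rewrite cardsD (setIidPr (center_sub_cent1 Gx)) oC // oZ.
rewrite sum1_card; apply: eq_card => y; rewrite unfold_in /=.
apply/andP/idP => [[Dy /eqP/(congr1 val)/= <-]|Cy].
  by case/setDP: Dy => Gy nZy; rewrite inE nZy inE Gy cent1id.
split; last by apply/eqP/val_inj; apply: eq_centraliser.
by case/setDP: Cy => /setIP[Gy _] nZy; rewrite inE nZy.
Qed.

Lemma quasi_antichain_cd_lattice : quasi_antichain (cd_lattice G) (q + 1).
Proof.
exists 'Z(G)%G, G; rewrite atoms_cd_lattice card_noncentral_centralisers.
split=> //; split.
- by rewrite is_minimum_cd_lattice.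
- exact: is_maximum_cd_lattice.
- exact: cd_lattice_abelian_centralisers.
- apply/andP; split; apply/negP => /noncentral_centraliserP[].
    by rewrite properxx.
  by rewrite properxx.
move=> A B /noncentral_centraliserP[_ _ oA _].
move=> /noncentral_centraliserP[_ _ oB _] sAB.
by apply/val_inj/eqP; rewrite eqEcard sAB oA oB leqnn.
Qed.

End AbelianCentralisers.

(** * Lower unitriangular matrices in coordinates *)

Section LowerUnitriangular.

Local Open Scope group_scope.
Local Open Scope ring_scope.

Variable F : finFieldType.

Local Notation P := (lower_unitriangular F).

Definition lut_mx (a b c : F) : 'M[F]_3 :=
  \matrix_(i, j) nth 0 (nth [::] [:: [:: 1; 0; 0]; [:: a; 1; 0]; [:: c; b; 1]]
                                 i) j.

Lemma lut_mx_trig (a b c : F) : is_trig_mx (lut_mx a b c).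
Proof.
apply/is_trig_mxP => i j; rewrite mxE.
by case: i => -[|[|[|i]]] // ?; case: j => -[|[|[|j]]].
Qed.

Lemma lut_mx_diag (a b c : F) (i : 'I_3) : lut_mx a b c i i = 1.
Proof. by rewrite mxE; case: i => -[|[|[|i]]]. Qed.

Lemma lut_mx_unit (a b c : F) : lut_mx a b c \is a GRing.unit.
Proof.
rewrite -[_ \is a _]/(lut_mx a b c \in unitmx) unitmxE.
rewrite det_trig ?lut_mx_trig // big1 ?unitr1 // => i _.
exact: lut_mx_diag.
Qed.

Definition lut (a b c : F) : {'GL_3[F]} :=
  FinRing.unit 'M[F]_3 (lut_mx_unit a b c).

Lemma lutM (a b c a' b' c' : F) :
  (lut a b c * lut a' b' c')%g = lut (a + a') (b + b') (c + b * a' + c').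
Proof.
apply: val_inj; rewrite /= -[LHS]/(lut_mx a b c *m lut_mx a' b' c').
apply/matrixP => i j; rewrite !mxE !big_ord_recl big_ord0 !mxE /=.
case: i => -[|[|[|i]]] // ?; case: j => -[|[|[|j]]] // ? /=;
  by rewrite ?(mul0r, mulr0, mul1r, mulr1, add0r, addr0, addrA).
Qed.

Lemma lut_inj (a b c a' b' c' : F) :
  lut a b c = lut a' b' c' -> [/\ a = a', b = b' & c = c'].
Proof.
move/(congr1 val) => /= /matrixP E.
have := (E (inord 1) ord0, E (inord 2) (inord 1), E (inord 2) ord0).
by rewrite !mxE !inordK //= => -[[-> ->] ->].
Qed.

Lemma lut_in (a b c : F) : lut a b c \in P.
Proof.
rewrite inE lut_mx_trig; apply/forallP => i /=.
by rewrite lut_mx_diag.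
Qed.

Lemma lutP (g : {'GL_3[F]}) : g \in P -> exists a b c, g = lut a b c.
Proof.
rewrite inE => /andP[/is_trig_mxP gT /forallP g1].
exists (GLval g (inord 1) ord0), (GLval g (inord 2) (inord 1)),
  (GLval g (inord 2) ord0).
apply: val_inj; apply/matrixP => i j; rewrite /= mxE.
(* Writing both indices as values of inord makes the entries of g match the
   arguments of lut syntactically. *)
have [i0 j0] : i = inord i /\ j = inord j by rewrite !inord_val.
case: i i0 => -[|[|[|i]]] // ? /= ->; case: j j0 => -[|[|[|j]]] // ? /= ->;
  try (by rewrite gT ?inordK); try (exact/eqP);
  by congr (GLval g _ _); apply: val_inj; rewrite /= inordK.
Qed.

Lemma commute_lut (a b c a' b' c' : F) :
  (lut a' b' c' \in 'C[lut a b c]) = (b * a' == b' * a).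
Proof.
apply/cent1P/eqP => [|E]; rewrite /commute !lutM.
  case/lut_inj=> _ _; rewrite -!addrA [c' + _]addrC [c + _]addrC -!addrA.
  by rewrite [c' + c]addrC => /addIr.
by rewrite [a' + a]addrC [b' + b]addrC addrAC E [in RHS]addrAC [c' + c]addrC.
Qed.

Lemma card_lut : #|P| = (#|F| ^ 3)%N.
Proof.
have -> : P :=: [set lut t.1.1 t.1.2 t.2 | t : F * F * F].
  apply/setP=> g; apply/idP/imsetP => [/lutP[a [b [c ->]]]|[t _ ->]].
    by exists (a, b, c).
  exact: lut_in.
rewrite card_imset ?card_prod ?expnS ?muln1 ?mulnA //.
by move=> [[a b] c] [[a' b'] c'] /lut_inj/= [-> -> ->].
Qed.

Lemma center_lut : 'Z(P) = [set lut 0 0 c | c : F].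
Proof.
apply/setP=> g; apply/centerP/imsetP => [[/lutP[a [b [c ->]]] cP]|[c _ ->]].
  have comm a' b' : b * a' = b' * a.
    apply/eqP; rewrite -(commute_lut _ _ c _ _ 0) cent1C.
    by apply/cent1P/cP/lut_in.
  exists c => //; have := (comm 1 0, comm 0 1).
  by rewrite mulr1 mul0r mulr0 mul1r => -[-> <-].
split=> [|h /lutP[a [b [c' ->]]]]; first exact: lut_in.
by apply/cent1P; rewrite commute_lut mul0r mulr0.
Qed.

Lemma card_center_lut : #|'Z(P)| = #|F|.
Proof. by rewrite center_lut card_imset // => c c' /lut_inj[]. Qed.

Lemma noncentral_lut (g : {'GL_3[F]}) : g \in P :\: 'Z(P) ->
  exists a b c, g = lut a b c /\ (a != 0) || (b != 0).
Proof.
case/setDP=> /lutP[a [b [c ->]]] nZ; exists a, b, c; split=> //.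
rewrite -negb_and; apply: contra nZ => /andP[/eqP-> /eqP->].
by rewrite center_lut imset_f.
Qed.

(** The vectors (a', b') with b a' = b' a are the multiples of the nonzero
    vector (a, b). *)
Lemma centraliser_lut (a b c : F) : (a != 0) || (b != 0) ->
  'C_P[lut a b c] = [set lut (t.1 * a) (t.1 * b) t.2 | t : F * F].
Proof.
move=> nz; apply/setP=> g; apply/setIP/imsetP => [[/lutP[a' [b' [c' ->]]]]|].
  rewrite commute_lut => /eqP E; case/orP: nz => nz.
    exists (a' / a, c') => //=.
    by rewrite divfK // mulrAC [a' * b]mulrC E mulfK.
  exists (b' / b, c') => //=.
  by rewrite divfK // mulrAC -E mulrAC divff // mul1r.
case=> -[t c'] _ -> /=; rewrite lut_in commute_lut; split=> //.
by rewrite mulrCA mulrA.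
Qed.

Lemma card_centraliser_lut (g : {'GL_3[F]}) :
  g \in P :\: 'Z(P) -> #|'C_P[g]| = (#|F| ^ 2)%N.
Proof.
case/noncentral_lut=> a [b [c [-> nz]]]; rewrite centraliser_lut //.
rewrite card_imset ?card_prod ?mulnn // => -[t u] [t' u'] /lut_inj/= [Ea Eb ->].
by case/orP: nz => nz; [rewrite (mulIf nz Ea)|rewrite (mulIf nz Eb)].
Qed.

Lemma abelian_centraliser_lut (g : {'GL_3[F]}) :
  g \in P :\: 'Z(P) -> abelian 'C_P[g].
Proof.
case/noncentral_lut=> a [b [c [-> nz]]]; rewrite centraliser_lut //.
apply/centsP=> _ /imsetP[[t u] _ ->] _ /imsetP[[t' u'] _ ->] /=.
apply/cent1P; rewrite commute_lut.
by rewrite mulrACA [t' * t]mulrC -mulrACA mulrCA !mulrA.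
Qed.

End LowerUnitriangular.

Unset Implicit Arguments.
Set Strict Implicit.

Theorem proposition9 (p n : nat) (hp : prime p) (hn : 0 < n)
    (F : finFieldType) (hF : #|F| = p ^ n) :
  quasi_antichain (cd_lattice (lower_unitriangular F)) (p ^ n + 1) /\
  (forall A : {group {'GL_3[F]}},
     A \in atoms (cd_lattice (lower_unitriangular F)) -> abelian A).
Proof.
have q_gt1 : 1 < #|F| := card_finNzRing_gt1 F.
have abelC := @abelian_centraliser_lut F.
have oC := @card_centraliser_lut F.
have oP := card_lut F; have oZ := card_center_lut F.
rewrite -hF; split; first exact: quasi_antichain_cd_lattice.
move=> A; rewrite (atoms_cd_lattice abelC q_gt1 oP oZ oC).
by case/(noncentral_centraliserP abelC q_gt1 oP oZ oC).
Qed.
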